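(* Let $A$ be a commutative ring with identity. Then the proper space $\mathrm{Prp}(A)$ (the set of all proper ideals of $A$ with the subspace topology induced from the ideal space $\mathrm{Idl}(A)$) is a spectral space.
   Context: $\mathrm{Idl}(A)$ denotes the set of all ideals of $A$ (including $A$ itself). For $\mathfrak{I}\in\mathrm{Idl}(A)$ put $\mathrm{v}(\mathfrak{I})=\{\mathfrak{S}\in\mathrm{Idl}(A)\mid \mathfrak{I}\subseteq\mathfrak{S}\}$. The ideal space is $\mathrm{Idl}(A)$ endowed with the coarse lower topology, i.e. the topology having $\{\mathrm{v}(\mathfrak{I})\mid \mathfrak{I}\in\mathrm{Idl}(A)\}$ as a closed subbase. $\mathrm{Prp}(A)$ is the set of all proper ideals of $A$ (so $A\notin\mathrm{Prp}(A)$), with the subspace topology from the ideal space $\mathrm{Idl}(A)$; it is called a proper space. A topological space is spectral if it is quasi-compact, sober (every non-empty irreducible closed subset has a unique generic point), and admits a basis of quasi-compact open subspaces that is closed under finite intersections. *)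

(* Defs.v *)
From HB Require Import structures.
From mathcomp Require Import all_boot all_order all_algebra.
From mathcomp Require Import boolp classical_sets filter topology.

Set Implicit Arguments.
Unset Strict Implicit.
Unset Printing Implicit Defensive.

Import GRing.Theory.
Local Open Scope classical_set_scope.
Local Open Scope ring_scope.

Section SpectralSpaces.
Variable T : topologicalType.

Definition irreducible (C : set T) : Prop :=
  C !=set0 /\
  forall F G : set T, closed F -> closed G ->
    C `<=` F `|` G -> C `<=` F \/ C `<=` G.

Definition sober_space : Prop :=
  forall C : set T, closed C -> irreducible C ->
    exists! x : T, closure [set x] = C.

(* [finI_from B id] also contains the empty intersection [setT].
   [cover_compact] is used rather than [compact] because the library relates
   the two only on pointed spaces. *)
Definition spectral_space : Prop :=
  [/\ cover_compact [set: T],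
      sober_space
    & exists B : set (set T),
        [/\ basis B,
            forall U, B U -> cover_compact U
          & finI_from B id `<=` B] ].

End SpectralSpaces.
Arguments sober_space : clear implicits.
Arguments spectral_space : clear implicits.

Section Ideals.
Variable A : comPzRingType.

(* The zero ring is allowed, and so is the improper ideal; the [idealr] of
   ring_quotient excludes both. *)
Definition is_ideal (I : set A) : Prop :=
  [/\ I 0,
      forall x y, I x -> I y -> I (x + y)
    & forall a x, I x -> I (a * x)].

Record Idl := MkIdl { ideal_set :> set A; idealP : is_ideal ideal_set }.

Lemma is_ideal_setT : is_ideal [set: A]. Proof. by []. Qed.

HB.instance Definition _ := gen_eqMixin Idl.
HB.instance Definition _ := gen_choiceMixin Idl.
(* A subbase has to be indexed by a pointed type. *)
HB.instance Definition _ := isPointed.Build Idl (MkIdl is_ideal_setT).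

Definition v (I : Idl) : set Idl := [set S : Idl | I `<=` S].

(* Coarse lower topology: the complements of the [v I] form an open subbase. *)
HB.instance Definition _ :=
  isSubBaseTopological.Build Idl [set: Idl] (fun I => ~` v I).

(* The coercion of [Prp] to a type carries the subspace topology, through the
   library instance on [set_type]. *)
Definition Prp : set Idl := [set I : Idl | I <> [set: A] :> set A].

End Ideals.
Arguments Prp : clear implicits.

(* Main.v *)
Require Import Defs.
From mathcomp Require Import all_boot all_order all_algebra.
From mathcomp Require Import finmap.
From mathcomp Require Import boolp classical_sets functions cardinality filter
  topology.

(** The complement of [v I] is the union, over the elements [a] of [I], of the
    sets of ideals that miss [a].  These sets are themselves subbasic, because an
    ideal misses [a] exactly when it does not contain the principal ideal of [a].
    So the sets [avoiding L] of ideals that miss every element of a finite list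
    [L] form a basis of the ideal space closed under finite intersections.

    Everything rests on the compactness of the sets [avoiding L] inside the
    ideal space.  An ultrafilter of ideals has a limit ideal, made of the
    elements that belong to almost every ideal of the ultrafilter; if almost
    every ideal misses [L], so does the limit ([compact_avoiding]).  An ideal is
    proper exactly when it misses [1], so a basic open set of the proper space
    is [avoiding (1 :: L)] seen in the subspace, and is compact; the proper
    space itself is the case [L = [::]].

    For sobriety, the closure of a proper ideal [x] is the set of proper ideals
    that contain [x] ([closure_Prp1]), so a generic point is unique, and the
    generic point of [C] has to be the intersection of the members of [C].  This
    intersection is proper because [C] is not empty.  It belongs to [C]:
    otherwise some [avoiding L] contains it and is disjoint from [C], which means
    that every member of [C] meets [L]; by irreducibility one [a] in [L] then
    lies in all members of [C], hence in their intersection, which misses [L]. *)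

Set Implicit Arguments.
Unset Strict Implicit.
Unset Printing Implicit Defensive.

Import GRing.Theory.
Local Open Scope classical_set_scope.
Local Open Scope ring_scope.

(** * Irreducible sets and compactness in a subspace *)

(** The definition of irreducibility splits a cover into two closed sets; in the
    induction the second one is the union of all remaining members. *)
Lemma irreducible_cover_seq (T : topologicalType) (I : choiceType) (C : set T)
    (V : I -> set T) (s : seq I) :
  irreducible C -> (forall i, closed (V i)) ->
  (forall x, C x -> exists2 i, i \in s & V i x) ->
  exists2 i, i \in s & C `<=` V i.
Proof.
move=> [[x Cx] irrC] Vcl.
elim: s => [|i s IHs] Cs; first by have [] := Cs x Cx.
have Ucl : closed (\bigcup_(j in [set` s]) V j).
  by apply: closed_bigcup => //; exact: finite_seq.
have [y Cy|CVi|CVs] := irrC (V i) (\bigcup_(j in [set` s]) V j) (Vcl i) Ucl.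
- have [j] := Cs y Cy; rewrite inE => /predU1P[->|js] Vjy; first by left.
  by right; exists j.
- by exists i; rewrite ?mem_head.
- have [|j js CVj] := IHs; first by move=> y /CVs[j]; exists j.
  by exists j; rewrite // in_cons js orbT.
Qed.

(** An open set of the subspace is the trace of an open set of [T].  A cover of
    the trace of [K] thus gives a family of open sets of [T], and this family
    covers all of [K] because [K] lies inside the subspace. *)
Lemma cover_compact_set_val (T : topologicalType) (A K : set T) :
  K `<=` A -> cover_compact K -> cover_compact (set_val @^-1` K : set A).
Proof.
move=> KA cK I D f fo Kf.
have /choice[g gP] i : exists W : set T,
    D i -> open W /\ (set_val @^-1` W : set A) = f i.
  have [Di|nDi] := pselect (D i); last by exists set0.
  by have [W Wo Wf] := fo i Di; exists W.
have [||D' D'D Kg] := cK I D g.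
- by move=> i /gP[].
- move=> x Kx; have Ax : x \in A by rewrite inE; exact: KA.
  have [i Di] := Kf (exist _ x Ax) Kx.
  by have [_ <-] := gP i Di; exists i.
- exists D' => // x /Kg[i iD' gix]; exists i => //.
  by have [|_ <-] := gP i; first by exact/set_mem/D'D.
Qed.

(** * The ideal space *)

Section IdealSpace.
Variable A : comPzRingType.
Implicit Types (S I : Idl A) (a : A) (L : seq A).

Lemma Idl_anti S I : S `<=` I -> I `<=` S -> S = I.
Proof.
case: S I => [S Sid] [I Iid] /= SI IS.
have eSI : S = I by apply/seteqP.
by case: _ / eSI in Iid SI IS *; congr MkIdl; exact: Prop_irrelevance.
Qed.

Definition avoiding L : set (Idl A) :=
  [set S : Idl A | forall a, a \in L -> ~ ideal_set S a].

Lemma avoiding_nil : avoiding [::] = setT.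
Proof. by apply/seteqP; split. Qed.

Lemma avoiding_cons a L :
  avoiding (a :: L) = ~` [set S : Idl A | ideal_set S a] `&` avoiding L.
Proof.
apply/seteqP; split=> S.
  move=> SL; split; first by exact/SL/mem_head.
  by move=> b bL; apply: SL; rewrite in_cons bL orbT.
by move=> [Sa SL] b; rewrite inE => /predU1P[->//|/SL].
Qed.

Lemma avoiding_cat L M : avoiding (L ++ M) = avoiding L `&` avoiding M.
Proof.
elim: L => [|a L IHL]; first by rewrite avoiding_nil setTI.
by rewrite cat_cons !avoiding_cons IHL setIA.
Qed.

Lemma Prp_avoiding1 : Prp A = avoiding [:: 1].
Proof.
apply/seteqP; split=> S.
  move=> Sprop a; rewrite inE => /eqP-> S1; apply: Sprop; apply/seteqP.
  by split=> // b _; have [_ _ /(_ b _ S1)] := idealP S; rewrite mulr1.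
by move=> /(_ 1 (mem_head _ _)) S1 ST; apply: S1; rewrite ST.
Qed.

Lemma is_ideal_principal a : is_ideal [set x | exists b, x = b * a].
Proof.
split=> [|x y [b ->] [c ->]|c x [b ->]].
- by exists 0; rewrite mul0r.
- by exists (b + c); rewrite mulrDl.
- by exists (c * b); rewrite mulrA.
Qed.

(** Makes the set of ideals that miss a single element subbasic open. *)
Lemma v_principal a :
  v (MkIdl (is_ideal_principal a)) = [set S : Idl A | ideal_set S a].
Proof.
apply/seteqP; split=> S /=.
  by apply; exists 1; rewrite mul1r.
by move=> Sa _ [b ->]; have [_ _] := idealP S; apply.
Qed.

Lemma closed_v I : closed (v I).
Proof.
rewrite -[v I]setCK; apply: open_closedC.
exists [set ~` v I]; last by rewrite bigcup_set1.
by move=> _ ->; apply: (@finI_from1 (Idl A) _ setT (fun J => ~` v J)).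
Qed.

Lemma closed_mem a : closed [set S : Idl A | ideal_set S a].
Proof. by rewrite -v_principal; exact: closed_v. Qed.

Lemma open_avoiding L : open (avoiding L).
Proof.
elim: L => [|a L IHL]; first by rewrite avoiding_nil; exact: openT.
by rewrite avoiding_cons; apply: openI IHL; exact/closed_openC/closed_mem.
Qed.

(** An ideal outside [v I] misses some element of [I], so one witness for each
    of the finitely many subbasic sets gives the list. *)
Lemma nbhs_avoiding S (U : set (Idl A)) :
  nbhs S U -> exists2 L, avoiding L S & avoiding L `<=` U.
Proof.
rewrite nbhsE => -[_ [[D DF <-] [W DW SW]] WU].
have [E _ EW] := DF _ DW.
have [L SL LE] : exists2 L, avoiding L S &
    forall S', avoiding L S' -> forall I, I \in enum_fset E -> ~ v I S'.
  have : forall I, I \in enum_fset E -> ~ v I S.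
    by move=> I IE; move: SW; rewrite -EW; apply.
  elim: (enum_fset E) => [|I s IHs] Ss; first by exists [::].
  have [J Js|L SL Ls] := IHs; first by apply: Ss; rewrite in_cons Js orbT.
  have /existsNP[a /not_implyP[Ia Sa]] := Ss I (mem_head _ _).
  exists (a :: L); first by rewrite avoiding_cons.
  move=> S'; rewrite avoiding_cons => -[S'a S'L] J.
  rewrite inE => /predU1P[->|].
    by move=> IS'; apply: S'a; exact: IS'.
  exact: Ls.
exists L => // S' /LE S'E; apply: WU; exists W => //.
(* The base derived from the subbase is indexed by its own sets. *)
by suff: W S' by []; rewrite -EW => I /S'E.
Qed.

Lemma is_ideal_limit (F : set_system (Idl A)) :
  Filter F -> is_ideal [set a | F [set S : Idl A | ideal_set S a]].
Proof.
move=> FF; split=> [|x y Fx Fy|a x Fx] /=.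
- by apply: filterS filterT => S _; have [] := idealP S.
- apply: filterS2 Fx Fy => S Sx Sy.
  by have [_ + _] := idealP S; apply.
- by apply: filterS Fx => S Sx; have [_ _] := idealP S; apply.
Qed.

(** An ultrafilter [F] converges to the ideal [J] of the elements that lie in
    [F]-almost every ideal: if [a] is not in [J], then, [F] being an ultrafilter,
    [F]-almost every ideal misses [a]. *)
Lemma compact_avoiding L : compact (avoiding L).
Proof.
rewrite compact_ultra => F FU FL; have FF : Filter F by exact: filter_filter.
pose J := MkIdl (is_ideal_limit FF); exists J; split.
  move=> a aL Ja.
  by have [S [/= Sa SL]] := filter_ex (filterI Ja FL); exact: SL Sa.
move=> U /nbhs_avoiding[M JM MU]; apply: filterS MU _.
elim: M JM => [|a M IHM]; first by rewrite avoiding_nil => _; exact: filterT.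
rewrite !avoiding_cons => -[Ja JM]; apply: filterI; last exact: IHM.
by have [] := in_ultra_setVsetC [set S : Idl A | ideal_set S a] FU.
Qed.

(** * The proper space *)

Definition Prp_avoiding L : set (Prp A) := set_val @^-1` avoiding L.

(** Compactness passes from the ideal space to a subspace only for sets that lie
    inside it; adding [1] to [L] removes the improper ideal from [avoiding L]
    and leaves its trace on the proper ideals unchanged. *)
Lemma cover_compact_Prp_avoiding L : cover_compact (Prp_avoiding L).
Proof.
have -> : Prp_avoiding L = set_val @^-1` avoiding (1 :: L).
  apply/seteqP; split=> x; rewrite /Prp_avoiding /preimage /=; last first.
    by rewrite avoiding_cons => -[].
  rewrite -cat1s avoiding_cat -Prp_avoiding1 => xL; split=> //.
  exact: set_valP.
apply: cover_compact_set_val.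
  by rewrite -cat1s avoiding_cat -Prp_avoiding1; exact: subIsetl.
by rewrite -compact_cover; exact: compact_avoiding.
Qed.

Lemma open_Prp_avoiding L : open (Prp_avoiding L).
Proof. by exists (avoiding L) => //; exact: open_avoiding. Qed.

Lemma nbhs_Prp_avoiding (x : Prp A) (U : set (Prp A)) :
  nbhs x U -> exists2 L, Prp_avoiding L x & Prp_avoiding L `<=` U.
Proof.
move=> [_ [[W Wo <-] Wx WU]].
have [L xL LW] := nbhs_avoiding (open_nbhs_nbhs (conj Wo Wx)).
by exists L => // y yL; apply: WU; exact: LW.
Qed.

Lemma closed_Prp_mem a : closed [set x : Prp A | ideal_set (set_val x) a].
Proof.
rewrite -[X in closed X]setCK; apply: open_closedC.
exists (~` [set S : Idl A | ideal_set S a]) => //.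
exact/closed_openC/closed_mem.
Qed.

Lemma closure_Prp1 (x : Prp A) :
  closure [set x] = set_val @^-1` v (set_val x).
Proof.
apply/seteqP; split=> y.
  move=> cly a xa; apply: (closed_Prp_mem (a := a)).
  by apply: closureS cly => _ ->.
move=> xy U /nbhs_Prp_avoiding[L yL LU]; exists x; split=> //.
by apply: LU => a aL /xy; exact: yL.
Qed.

Lemma is_ideal_bigcap (C : set (Idl A)) :
  is_ideal (\bigcap_(S in C) (S : set A)).
Proof.
split=> [S _|x y Cx Cy S CS|a x Cx S CS]; have [S0 SD SM] := idealP S.
- exact: S0.
- by apply: SD; [exact: Cx|exact: Cy].
- by apply: SM; exact: Cx.
Qed.

Lemma sober_Prp : sober_space (Prp A).
Proof.
move=> C Ccl Cirr; have [[c Cc] _] := Cirr.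
pose J := MkIdl (is_ideal_bigcap (set_val @` C)).
have Jsub (y : Prp A) : C y -> J `<=` set_val y.
  by move=> Cy a; apply; exists y.
have JP : J \in Prp A.
  have /seteqP[Prp_sub _] := Prp_avoiding1.
  rewrite inE Prp_avoiding1 => a a1 /(Jsub c Cc).
  exact: (Prp_sub _ (set_valP c)).
pose x : Prp A := exist _ J JP.
have Cx : C x.
  apply: contrapT => nCx.
  have /nbhs_Prp_avoiding[L xL LC] : nbhs x (~` C).
    by apply: open_nbhs_nbhs; split; [exact: closed_openC|].
  have meetL (y : Prp A) : C y -> exists2 a, a \in L & ideal_set (set_val y) a.
    move=> Cy; apply: contrapT => nyL; apply: (LC y) Cy => a aL ya.
    by apply: nyL; exists a.
  have [a aL Ca] := irreducible_cover_seq Cirr closed_Prp_mem meetL.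
  by apply: (xL a aL) => _ [y Cy <-]; exact: Ca.
exists x; split.
  apply/seteqP; split=> [y cly|y Cy]; last by rewrite closure_Prp1; exact: Jsub.
  by apply: Ccl; apply: closureS cly => _ ->.
move=> y clyC; apply: val_inj; apply: Idl_anti.
  by apply: (Jsub y); rewrite -clyC; exact: subset_closure.
by move: Cx; rewrite -clyC closure_Prp1.
Qed.

End IdealSpace.

Theorem theorem2p9 (A : comPzRingType) : spectral_space (Prp A).
Proof.
split; [|exact: sober_Prp|].
  have -> : [set: Prp A] = Prp_avoiding [::].
    by rewrite /Prp_avoiding avoiding_nil preimage_setT.
  exact: cover_compact_Prp_avoiding.
exists (range (@Prp_avoiding A)); split.
- split; first by move=> _ [L _ <-]; exact: open_Prp_avoiding.
  move=> x U /nbhs_Prp_avoiding[L xL LU].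
  by exists (Prp_avoiding L) => //; split=> //; exists L.
- by move=> _ [L _ <-]; exact: cover_compact_Prp_avoiding.
- move=> _ [E EB <-].
  rewrite bigcap_fset big_seq; apply: big_ind => [|U V [L _ <-] [M _ <-]|U UE].
  + by exists [::] => //; rewrite /Prp_avoiding avoiding_nil preimage_setT.
  + by exists (L ++ M) => //; rewrite /Prp_avoiding avoiding_cat preimage_setI.
  + exact/set_mem/EB.
Qed.
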